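(* Let $\alpha_t,\beta,D>0$, let $\sigma:\mathbb{R}^{m,n}\to\mathbb{R}^{\min\{m,n\}}$ be the function mapping a matrix to its singular values, and let $$\phi_t:\mathbb{R}^{\min\{m,n\}}\to\mathbb{R},\quad \phi_t(x)=\alpha_t\sum_{i=1}^{\min\{m,n\}}\Big((|x_i|+\beta)\ln\Big(\frac{|x_i|}{\beta}+1\Big)-|x_i|\Big).$$ Then the function $\Phi_t=\phi_t\circ\sigma$ is $\frac{\alpha_t}{2(D+\min\{m,n\}\beta)}$-strongly convex with respect to the nuclear norm over the nuclear ball $\{X\in\mathbb{R}^{m,n}:\|X\|_1\le D\}$ with radius $D$.
   Context: For matrices, $\|\cdot\|_1$ denotes the nuclear norm (sum of singular values). A function $f$ is $\eta$-strongly convex with respect to a norm $\|\cdot\|$ over a convex set $\mathcal{K}$ if $f(x)-f(y)\ge\langle\nabla f(y),x-y\rangle+\frac{\eta}{2}\|x-y\|^2$ for all $x,y\in\mathcal{K}$ and every subgradient $\nabla f(y)\in\partial f(y)$. On $\mathbb{R}^{m,n}$ (real $m\times n$ matrices), $\langle\cdot,\cdot\rangle$ is the Frobenius inner product. *)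

(* Defs.v *)
From HB Require Import structures.
From mathcomp Require Import all_boot all_order all_algebra.
From mathcomp Require Import polyrcf.
From mathcomp Require Import boolp classical_sets reals exp.

Set Implicit Arguments.
Unset Strict Implicit.
Unset Printing Implicit Defensive.
Import Order.TTheory GRing.Theory Num.Theory.
Local Open Scope classical_set_scope.
Local Open Scope ring_scope.

Section Defs.
Variable R : realType.

(* [rootsR p] is the increasing list of the distinct roots of [p], so this is
   the nonincreasing list of the real roots of the characteristic polynomial,
   each repeated according to its algebraic multiplicity. *)
Definition eigenvalues n (A : 'M[R]_n) : seq R :=
  rev (flatten [seq nseq (mup x (char_poly A)) x | x <- rootsR (char_poly A)]).

(* [X^T *m X] has n eigenvalues, all real and nonnegative; those beyond the
   first min(m, n) are zero. *)
Definition sigma m n (X : 'M[R]_(m, n)) : 'rV[R]_(minn m n) :=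
  \row_i Num.sqrt (nth 0 (eigenvalues (X^T *m X)) i).

Definition nuclear_norm m n (X : 'M[R]_(m, n)) : R := \sum_i sigma X 0 i.

Definition nuclear_ball m n (D : R) : set 'M[R]_(m, n) :=
  [set X | nuclear_norm X <= D].

Definition frobenius m n (A B : 'M[R]_(m, n)) : R :=
  \sum_i \sum_j A i j * B i j.

Definition subdifferential m n (f : 'M[R]_(m, n) -> R) (Y : 'M[R]_(m, n)) :
    set 'M[R]_(m, n) :=
  [set G | forall X, f Y + frobenius G (X - Y) <= f X].

Definition strongly_convex m n (eta : R) (nrm : 'M[R]_(m, n) -> R)
    (K : set 'M[R]_(m, n)) (f : 'M[R]_(m, n) -> R) : Prop :=
  forall X Y, K X -> K Y -> forall G, subdifferential f Y G ->
    frobenius G (X - Y) + eta / 2 * nrm (X - Y) ^+ 2 <= f X - f Y.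

Definition phi k (alpha beta : R) (x : 'rV[R]_k) : R :=
  alpha * \sum_i ((`|x 0 i| + beta) * ln (`|x 0 i| / beta + 1) - `|x 0 i|).

End Defs.

Arguments nuclear_norm {R m n} X.
Arguments nuclear_ball {R} m n D.
Arguments sigma {R m n} X.
Arguments phi {R k} alpha beta x.

(* Main.v *)
Require Import Defs.
From mathcomp Require Import all_boot all_order all_algebra.
From mathcomp Require Import complex polyrcf.
From mathcomp Require Import boolp classical_sets reals exp.
From mathcomp Require Import ring lra.
Import Order.TTheory GRing.Theory Num.Theory.
Local Open Scope ring_scope.

Set Implicit Arguments.
Unset Strict Implicit.
Unset Printing Implicit Defensive.

(** Write [f x = (|x| + beta) ln (|x| / beta + 1) - |x|], so that the function
    at stake is [alpha * h] with [h X] the sum of [f] over the singular values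
    of [X], and let [k = min(m, n)], [K = D + k * beta].

    The matrix [X] is replaced by the symmetric matrix
    [S(X) = block_mx 0 X X^T 0], whose nonzero eigenvalues are the nonzero
    singular values of [X] and their opposites: as [f] is even and [f 0 = 0],
    [Tr f(S(X)) = 2 h X], and likewise the absolute values of the eigenvalues
    of [S(X)] add up to twice the nuclear norm ([sum_dilation_spectrum]).

    For symmetric matrices with orthonormal eigenbases [A : a_i, p_i] and
    [B : b_j, q_j], Klein's identity ([klein_identity]) reads
      [Tr f(A) - Tr f(B) - Tr (f'(B) (A - B))
         = sum_ij (p_i . q_j)^2 (f a_i - f b_j - f' b_j (a_i - b_j))],
    and in the same mixed bases, for any matrix [U],
      [Tr (U (A - B)) = sum_ij (p_i . q_j) (p_i U q_j) (a_i - b_j)].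
    The scalar inequality
      [f x - f y - f' y (x - y) >= (x - y)^2 / (2 (|x| + |y| + 2 beta))]
    ([hypentropy_bregman]) has a weight that is a sum of a function of [x], a
    function of [y] and a constant. So if [U] is a contraction, Cauchy-Schwarz
    bounds the Bregman divergence of [Tr f] below by
    [Tr (U (A - B))^2 / (2 W)], where
      [W = sum_i |a_i| + sum_j |b_j| + 2 beta Tr (U U^T)]
    ([trace_bregman_lower_bound]).

    Take [A = S(X)], [B = S(Z)] with [X], [Z] in the ball and [U] the sign of
    [S(H)] where [X - Z] is a multiple of [H]. Then [Tr (U S(H))] is twice the
    nuclear norm of [H], and [U U^T] is a projector of rank at most [2 k], so
    [W <= 4 K] ([hypentropy_strong_tangent]).

    An arbitrary subgradient [G] at [Y] is reached through the segment from [Y]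
    to [X]. Apply the previous bound at [Z = Y + t (X - Y)], once towards [X]
    and once towards [Y]: the linear terms cancel in the convex combination,
    which leaves strong convexity along the segment
    ([hypentropy_trace_segment]). The inequality that defines [G], taken at
    [Z], then gives the claim up to a factor [1 - t], and [t] tends to [0]. *)

(** * The spectral theorem for real symmetric matrices *)

Section RealSpectralTheorem.
Variable R : rcfType.

(** Over the complex numbers an eigenvalue exists, and comparing
    [v A v^*] with its conjugate shows that it is real. *)
Lemma symmetric_eigenvalue n (A : 'M[R]_n.+1) :
  A^T = A -> exists a, eigenvalue A a.
Proof.
move=> symA.
pose rc : {rmorphism R -> R[i]} := real_complex R.
pose B : 'M[R[i]]_n.+1 := map_mx rc A.
have [|l] := eigenvalue_closed B; first by [].
move=> /[dup] eigl /eigenvalueP[v vB v0].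
have conjB : map_mx Num.conj B = B.
  by apply/matrixP => i j; rewrite !mxE; apply/CrealP/complex_realP; exists (A i j).
have symB : B^T = B by rewrite /B map_trmx symA.
have nv0 : (v *m (map_mx Num.conj v)^T) 0 0 != 0.
  apply: contra v0 => /eqP; rewrite mxE => /eqP.
  rewrite psumr_eq0 => [/allP vz|i _]; last first.
    by rewrite !mxE mul_conjC_ge0.
  apply/eqP/rowP => i; rewrite mxE; apply/eqP.
  have := vz i (mem_index_enum _).
  by rewrite !mxE mul_conjC_eq0.
have lE : l * (v *m (map_mx Num.conj v)^T) 0 0
        = Num.conj l * (v *m (map_mx Num.conj v)^T) 0 0.
  have -> : l * (v *m (map_mx Num.conj v)^T) 0 0
          = (v *m B *m (map_mx Num.conj v)^T) 0 0.
    by rewrite vB -scalemxAl [RHS]mxE.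
  rewrite -mulmxA.
  have -> : B *m (map_mx Num.conj v)^T = Num.conj l *: (map_mx Num.conj v)^T.
    by rewrite -{1}symB -trmx_mul -{1}conjB -map_mxM vB map_mxZ linearZ.
  by rewrite -scalemxAr mxE.
have /CrealP/complex_realP[x lx] : Num.conj l = l.
  by apply/esym/(mulIf nv0).
exists x; rewrite eigenvalue_root_char.
move: eigl; rewrite eigenvalue_root_char /B -map_char_poly lx.
by rewrite -/(rc x) fmorph_root.
Qed.

(** Unless [v] is the first basis vector [e], the Householder reflection along
    [v - e] is symmetric, orthogonal and exchanges [e] and [v]. *)
Lemma orthogonal_first_row n (v : 'rV[R]_n.+1) : v *m v^T = 1%:M ->
  exists2 Q : 'M[R]_n.+1, Q *m Q^T = 1%:M & row 0 Q = v.
Proof.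
move=> vv.
pose e : 'rV[R]_n.+1 := delta_mx 0 0.
have [ve|ve] := eqVneq v e.
  by exists 1%:M; rewrite ?trmx1 ?mulmx1 // ve row1.
have [w wE] : exists w, w = v - e by exists (v - e).
pose c := (w *m w^T) 0 0.
have ee : e *m e^T = 1%:M.
  by rewrite trmx_delta mul_delta_mx; apply/matrixP=> i j; rewrite !mxE !ord1.
have evT : v *m e^T = (v 0 0)%:M.
  apply/matrixP => i j; rewrite !ord1 !mxE (bigD1 0) //= !mxE eqxx mulr1.
  by rewrite big1 ?addr0 // => k /negPf k0; rewrite !mxE k0 mulr0.
have veT : e *m v^T = (v 0 0)%:M by rewrite -[LHS]trmxK trmx_mul trmxK evT tr_scalar_mx.
have wwE : w *m w^T = c%:M by rewrite [LHS]mx11_scalar.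
have cE : c = 2 * (1 - v 0 0).
  rewrite /c wE linearB /= mulmxBl !mulmxBr vv evT veT ee !mxE eqxx !mulr1n.
  by ring.
have c0 : c != 0.
  apply: contra ve => /eqP; rewrite /c mxE => /eqP.
  rewrite psumr_eq0 => [/allP wz|i _]; last by rewrite [w^T _ _]mxE -expr2 sqr_ge0.
  rewrite -subr_eq0 -wE; apply/eqP/rowP => i; rewrite [RHS]mxE; apply/eqP.
  by have := wz i (mem_index_enum _); rewrite [w^T _ _]mxE -expr2 sqrf_eq0.
pose Q := 1%:M - (2 / c) *: (w^T *m w).
have QT : Q^T = Q by rewrite /Q linearB /= trmx1 linearZ /= trmx_mul trmxK.
have WW : w^T *m w *m (w^T *m w) = c *: (w^T *m w).
  by rewrite mulmxA -(mulmxA w^T) wwE mul_mx_scalar scalemxAl.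
exists Q.
  rewrite QT /Q mulmxBl mul1mx mulmxBr mulmx1 -scalemxAr -!scalemxAl WW !scalerA.
  rewrite -scalerBl -addrA -scaleNr -scaleNr -scalerDl.
  have -> : - (2 / c) + - (2 / c - 2 / c * (2 / c) * c) = 0 by field.
  by rewrite scale0r addr0.
rewrite rowE -/e /Q mulmxBr mulmx1 -scalemxAr mulmxA.
have -> : e *m w^T = (v 0 0 - 1)%:M.
  by rewrite wE linearB /= mulmxBr veT ee -raddfB.
rewrite mul_scalar_mx scalerA.
have -> : 2 / c * (v 0 0 - 1) = - 1.
  by rewrite mulrAC -[v 0 0 - 1]opprB mulrN -cE mulNr divff.
by rewrite scaleN1r opprK wE addrC subrK.
Qed.

(** The rows of [P] are an orthonormal basis of eigenvectors, with eigenvalues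
    the entries of [d]. *)
Definition spectral_decomposition n (A P : 'M[R]_n) (d : 'rV[R]_n) :=
  P *m P^T = 1%:M /\ A = P^T *m diag_mx d *m P.

(** Deflation: in an orthonormal basis that starts with an eigenvector, a
    symmetric matrix is block diagonal with a first block of size 1. *)
Theorem real_spectral_theorem n (A : 'M[R]_n) : A^T = A ->
  exists P d, spectral_decomposition A P d.
Proof.
elim: n A => [|n IH] A symA.
  by exists 1%:M, 0; split; apply/matrixP => -[].
have [a /eigenvalueP[v0 v0A v0n]] := symmetric_eigenvalue symA.
pose c := \sum_i v0 0 i ^+ 2.
have c_gt0 : 0 < c.
  rewrite lt_def sumr_ge0 ?andbT => [|i _]; last exact: sqr_ge0.
  apply: contra v0n; rewrite psumr_eq0 => [/allP vz|i _]; last exact: sqr_ge0.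
  apply/eqP/rowP => i; rewrite [RHS]mxE; apply/eqP.
  by have := vz i (mem_index_enum _); rewrite /= sqrf_eq0.
pose v := (Num.sqrt c)^-1 *: v0.
have vv : v *m v^T = 1%:M.
  rewrite [LHS]mx11_scalar mxE; congr (_%:M).
  under eq_bigr do rewrite !mxE -expr2 exprMn.
  by rewrite -mulr_sumr -/c exprVn sqr_sqrtr ?ltW // mulVf ?gt_eqF.
have vA : v *m A = a *: v by rewrite -scalemxAl v0A !scalerA mulrC.
have [Q QQ rQ] := orthogonal_first_row vv.
pose B : 'M[R]_(1 + n) := Q *m A *m Q^T.
have symB : B^T = B by rewrite /B !trmx_mul trmxK symA mulmxA.
have rB : row 0 B = a *: delta_mx 0 0.
  rewrite /B !row_mul rQ vA -scalemxAl -rQ -row_mul QQ.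
  by rewrite row1.
have ulB : ulsubmx B = a%:M.
  apply/matrixP => i j; rewrite !ord1 !mxE.
  have -> : lshift n 0 = 0 :> 'I_(1 + n) by exact/val_inj.
  have := congr1 (fun r : 'rV_n.+1 => r 0 0) rB.
  by rewrite !mxE !eqxx mulr1.
have urB : ursubmx B = 0.
  apply/matrixP => i j; rewrite !ord1 !mxE.
  have -> : lshift n 0 = 0 :> 'I_(1 + n) by exact/val_inj.
  have := congr1 (fun r : 'rV_n.+1 => r 0 (rshift 1 j)) rB.
  by rewrite !mxE /= mulr0.
have dlB : dlsubmx B = 0 by rewrite -[LHS]trmxK trmx_dlsub symB urB trmx0.
have symB' : (drsubmx B)^T = drsubmx B by rewrite trmx_drsub symB.
have [P' [d' [PP' B'E]]] := IH _ symB'.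
have BE : B = block_mx a%:M 0 0 (drsubmx B) by rewrite -{1}[B]submxK ulB urB dlB.
pose P1 : 'M[R]_(1 + n) := block_mx 1%:M 0 0 P'.
have P1T : P1^T = block_mx 1%:M 0 0 P'^T.
  by rewrite /P1 tr_block_mx !trmx0 trmx1.
have P1P1 : P1 *m P1^T = 1%:M.
  rewrite P1T /P1 mulmx_block !mul0mx !mulmx0 mulmx1 PP' !addr0 add0r.
  by rewrite -scalar_mx_block.
have BP1 : B = P1^T *m diag_mx (row_mx a%:M d') *m P1.
  rewrite [in LHS]BE B'E P1T /P1 diag_mx_row !mulmx_block.
  rewrite !(mul0mx, mulmx0, mul1mx, mulmx1, addr0, add0r).
  by congr block_mx; apply/matrixP => i j; rewrite !ord1 !mxE eqxx !mulr1n.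
exists (P1 *m Q), (row_mx a%:M d' : 'rV_(1 + n)); split.
  by rewrite trmx_mul mulmxA -(mulmxA _ Q) QQ mulmx1.
have QTQ : Q^T *m Q = 1%:M by apply: mulmx1C.
have -> : A = Q^T *m B *m Q.
  by rewrite /B !mulmxA QTQ mul1mx -mulmxA QTQ mulmx1.
by rewrite BP1 trmx_mul !mulmxA.
Qed.
End RealSpectralTheorem.

(** * Bregman divergences of spectral trace functions *)

Section TraceBregman.
Variable R : rcfType.

Lemma orthogonal_row_sum n (C : 'M[R]_n) i :
  C *m C^T = 1%:M -> \sum_j C i j ^+ 2 = 1.
Proof.
move=> /matrixP/(_ i i); rewrite !mxE eqxx mulr1n => <-.
by apply: eq_bigr => j _; rewrite mxE expr2.
Qed.

Lemma orthogonal_col_sum n (C : 'M[R]_n) j :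
  C *m C^T = 1%:M -> \sum_i C i j ^+ 2 = 1.
Proof.
move=> /mulmx1C/matrixP/(_ j j); rewrite !mxE eqxx mulr1n => <-.
by apply: eq_bigr => i _; rewrite mxE expr2.
Qed.

Lemma orthogonal_mulmxT n (P Q : 'M[R]_n) :
  P *m P^T = 1%:M -> Q *m Q^T = 1%:M -> (P *m Q^T) *m (P *m Q^T)^T = 1%:M.
Proof.
move=> PP /mulmx1C QQ.
by rewrite trmx_mul trmxK mulmxA -(mulmxA P) QQ mulmx1.
Qed.

(** The functional calculus [g(A)], for the decomposition [(P, d)] of [A]. *)
Definition spectral_fun n (g : R -> R) (P : 'M[R]_n) (d : 'rV[R]_n) :=
  P^T *m diag_mx (map_mx g d) *m P.

Lemma mxtrace_mul_spectral n (M A P : 'M[R]_n) d :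
  spectral_decomposition A P d ->
  \tr (M *m A) = \sum_i (P *m M *m P^T) i i * d 0 i.
Proof.
case=> PP ->; rewrite mulmxA mxtrace_mulC !mulmxA.
rewrite /mxtrace; apply: eq_bigr => i _.
by rewrite mul_mx_diag mxE.
Qed.

Lemma spectral_entry n (g : R -> R) (P Q : 'M[R]_n) d i :
  (P *m spectral_fun g Q d *m P^T) i i = \sum_j (P *m Q^T) i j ^+ 2 * g (d 0 j).
Proof.
have -> : P *m spectral_fun g Q d *m P^T =
   (P *m Q^T) *m diag_mx (map_mx g d) *m (P *m Q^T)^T.
  by rewrite /spectral_fun trmx_mul trmxK !mulmxA.
rewrite mxE; apply: eq_bigr => j _.
by rewrite mul_mx_diag !mxE; ring.
Qed.

Lemma mxtrace_spectral_fun n (g : R -> R) (A P Q : 'M[R]_n) a b :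
  spectral_decomposition A P a ->
  \tr (spectral_fun g Q b *m A)
    = \sum_i \sum_j (P *m Q^T) i j ^+ 2 * (a 0 i * g (b 0 j)).
Proof.
move=> /mxtrace_mul_spectral ->; apply: eq_bigr => i _.
rewrite spectral_entry mulr_suml; apply: eq_bigr => j _; ring.
Qed.

Lemma mxtrace_spectral_fun_self n (g : R -> R) (A P : 'M[R]_n) a :
  spectral_decomposition A P a ->
  \tr (spectral_fun g P a *m A) = \sum_i a 0 i * g (a 0 i).
Proof.
move=> dA; rewrite (mxtrace_mul_spectral _ dA); apply: eq_bigr => i _.
case: dA => PP _; rewrite spectral_entry PP (bigD1 i) //= big1.
  by rewrite !mxE eqxx expr1n; ring.
by move=> j ji; rewrite !mxE eq_sym (negPf ji) expr0n mul0r.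
Qed.

(** The diagonal of a symmetric contraction lies between -1 and 1 in any
    orthonormal basis; read it in the eigenbasis of [A]. *)
Lemma mxtrace_contraction_le n (g : R -> R) (A P V : 'M[R]_n) a v :
  (forall x, `|g x| <= 1) ->
  spectral_decomposition A P a -> V *m V^T = 1%:M ->
  \tr (spectral_fun g V v *m A) <= \sum_i `|a 0 i|.
Proof.
move=> g1 dA VV; rewrite (mxtrace_mul_spectral _ dA); apply: ler_sum => i _.
apply: le_trans (ler_norm _) _; rewrite normrM ler_piMl // spectral_entry.
rewrite -(orthogonal_row_sum i (orthogonal_mulmxT (proj1 dA) VV)).
apply: le_trans (ler_norm_sum _ _ _) _; apply: ler_sum => j _.
by rewrite normrM ger0_norm ?sqr_ge0 // ler_piMr ?sqr_ge0.
Qed.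

(** The squared entries of the orthogonal matrix [P *m Q^T] that relates the two
    eigenbases form a doubly stochastic matrix, so each term on the left is
    a double sum with these weights. *)
Lemma klein_identity n (f f' : R -> R) (A P B Q : 'M[R]_n) a b :
  spectral_decomposition A P a -> spectral_decomposition B Q b ->
  \sum_i f (a 0 i) - \sum_j f (b 0 j) - \tr (spectral_fun f' Q b *m (A - B))
  = \sum_i \sum_j (P *m Q^T) i j ^+ 2
      * (f (a 0 i) - f (b 0 j) - f' (b 0 j) * (a 0 i - b 0 j)).
Proof.
move=> dA dB.
have CC := orthogonal_mulmxT (proj1 dA) (proj1 dB).
have -> : \sum_i f (a 0 i) = \sum_i \sum_j (P *m Q^T) i j ^+ 2 * f (a 0 i).
  by apply: eq_bigr => i _; rewrite -mulr_suml (orthogonal_row_sum i CC) mul1r.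
have sumb g : \sum_j g (b 0 j) = \sum_i \sum_j (P *m Q^T) i j ^+ 2 * g (b 0 j).
  rewrite exchange_big; apply: eq_bigr => j _.
  by rewrite -mulr_suml (orthogonal_col_sum j CC) mul1r.
rewrite mulmxBr linearB /= (mxtrace_spectral_fun _ _ _ dA).
rewrite (mxtrace_spectral_fun_self _ dB) (sumb f) (sumb (fun x => x * f' x)).
rewrite -!sumrB; apply: eq_bigr => i _; rewrite -!sumrB; apply: eq_bigr => j _.
ring.
Qed.

(** Read in the eigenbases of [A] on the left and of [B] on the right, [A - B]
    has entries [(a_i - b_j)] times those of the transition matrix: this is why
    the trace can be compared with the divergence in [klein_identity]. *)
Lemma mxtrace_mulB_spectral n (M A P B Q : 'M[R]_n) a b :
  spectral_decomposition A P a -> spectral_decomposition B Q b ->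
  \tr (M *m (A - B))
  = \sum_i \sum_j (P *m Q^T) i j * (P *m M *m Q^T) i j * (a 0 i - b 0 j).
Proof.
move=> dA dB; rewrite mulmxBr linearB /=.
rewrite (mxtrace_mul_spectral _ dA) (mxtrace_mul_spectral _ dB).
have -> : P *m M *m P^T = (P *m M *m Q^T) *m (P *m Q^T)^T.
  by rewrite trmx_mul trmxK mulmxA -(mulmxA _ Q^T) (mulmx1C (proj1 dB)) mulmx1.
have -> : Q *m M *m Q^T = (P *m Q^T)^T *m (P *m M *m Q^T).
  by rewrite trmx_mul trmxK !mulmxA -(mulmxA _ P^T) (mulmx1C (proj1 dA)) mulmx1.
have -> : \sum_i ((P *m M *m Q^T) *m (P *m Q^T)^T) i i * a 0 i =
    \sum_i \sum_j (P *m Q^T) i j * (P *m M *m Q^T) i j * a 0 i.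
  apply: eq_bigr => i _; rewrite [X in X * _]mxE mulr_suml; apply: eq_bigr => j _.
  by rewrite [(P *m Q^T)^T _ _]mxE [_ * (P *m Q^T) _ _]mulrC.
have -> : \sum_j ((P *m Q^T)^T *m (P *m M *m Q^T)) j j * b 0 j =
    \sum_i \sum_j (P *m Q^T) i j * (P *m M *m Q^T) i j * b 0 j.
  rewrite [RHS]exchange_big /=; apply: eq_bigr => j _.
  rewrite [X in X * _]mxE mulr_suml; apply: eq_bigr => i _.
  by rewrite [(P *m Q^T)^T _ _]mxE.
rewrite -!sumrB; apply: eq_bigr => i _; rewrite -!sumrB; apply: eq_bigr => j _.
by rewrite mulrBr.
Qed.

Lemma spectral_fun_rows n (g : R -> R) (P Q V : 'M[R]_n) v i :
  P *m P^T = 1%:M -> Q *m Q^T = 1%:M -> V *m V^T = 1%:M ->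
  \sum_j (P *m spectral_fun g V v *m Q^T) i j ^+ 2
   = \sum_k (P *m V^T) i k ^+ 2 * g (v 0 k) ^+ 2.
Proof.
move=> PP QQ VV; pose E := P *m spectral_fun g V v *m Q^T.
have -> : \sum_j (P *m spectral_fun g V v *m Q^T) i j ^+ 2 = (E *m E^T) i i.
  by rewrite mxE; apply: eq_bigr => j _; rewrite [E^T _ _]mxE expr2.
have -> : E *m E^T = P *m spectral_fun (fun x => g x ^+ 2) V v *m P^T.
  rewrite /E !trmx_mul !trmxK tr_diag_mx !mulmxA -(mulmxA _ Q^T) (mulmx1C QQ) mulmx1.
  rewrite -(mulmxA _ V V^T) VV mulmx1 -(mulmxA _ (diag_mx _) (diag_mx _)) mulmx_diag.
  congr (_ *m diag_mx _ *m _ *m _).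
  by apply/rowP=> k; rewrite !mxE expr2.
by rewrite spectral_entry.
Qed.

Lemma spectral_fun_cols n (g : R -> R) (P Q V : 'M[R]_n) v j :
  P *m P^T = 1%:M -> Q *m Q^T = 1%:M -> V *m V^T = 1%:M ->
  \sum_i (P *m spectral_fun g V v *m Q^T) i j ^+ 2
   = \sum_k (Q *m V^T) j k ^+ 2 * g (v 0 k) ^+ 2.
Proof.
move=> PP QQ VV; rewrite -(spectral_fun_rows _ _ _ QQ PP VV).
apply: eq_bigr => i _.
have -> : Q *m spectral_fun g V v *m P^T = (P *m spectral_fun g V v *m Q^T)^T.
  by rewrite !trmx_mul !trmxK tr_diag_mx !mulmxA.
by rewrite [X in _ = X ^+ 2]mxE.
Qed.

(** The rows and columns of a contraction have norm at most 1 in any pair of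
    orthonormal bases, which takes care of weights depending on one index; for
    a constant weight the sum is the Frobenius norm, computed from the
    spectrum. *)
Lemma weighted_contraction_le n (g : R -> R) (P Q V : 'M[R]_n) v
    (wa wb : 'I_n -> R) c :
  (forall x, `|g x| <= 1) ->
  P *m P^T = 1%:M -> Q *m Q^T = 1%:M -> V *m V^T = 1%:M ->
  (forall i, 0 <= wa i) -> (forall j, 0 <= wb j) ->
  \sum_i \sum_j (P *m spectral_fun g V v *m Q^T) i j ^+ 2 * (wa i + wb j + c)
   <= \sum_i wa i + \sum_j wb j + c * \sum_k g (v 0 k) ^+ 2.
Proof.
move=> g1 PP QQ VV wa0 wb0.
have g2 x : g x ^+ 2 <= 1.
  by rewrite -real_normK ?num_real // expr_le1.
set E := P *m _ *m Q^T.
have split3 i : \sum_j E i j ^+ 2 * (wa i + wb j + c) =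
   (\sum_j E i j ^+ 2) * wa i + \sum_j E i j ^+ 2 * wb j + c * \sum_j E i j ^+ 2.
  rewrite mulr_suml mulr_sumr -!big_split; apply: eq_bigr => j _ /=; ring.
under eq_bigr do rewrite split3.
rewrite !big_split /=; apply: lerD; first apply: lerD.
- apply: ler_sum => i _; rewrite spectral_fun_rows // ler_piMl //.
  rewrite -(orthogonal_row_sum i (orthogonal_mulmxT PP VV)).
  by apply: ler_sum => k _; rewrite ler_piMr ?sqr_ge0.
- rewrite exchange_big; apply: ler_sum => j _ /=.
  rewrite -mulr_suml spectral_fun_cols // ler_piMl //.
  rewrite -(orthogonal_row_sum j (orthogonal_mulmxT QQ VV)).
  by apply: ler_sum => k _; rewrite ler_piMr ?sqr_ge0.
- rewrite -mulr_sumr le_eqVlt; apply/orP; left; apply/eqP; congr (c * _).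
  transitivity (\sum_i \sum_k (P *m V^T) i k ^+ 2 * g (v 0 k) ^+ 2).
    by apply: eq_bigr => i _; rewrite spectral_fun_rows.
  rewrite exchange_big /=; apply: eq_bigr => k _.
  by rewrite -mulr_suml (orthogonal_col_sum _ (orthogonal_mulmxT PP VV)) mul1r.
Qed.

(** A scalar lower bound on the Bregman divergence of [f] with an additive
    weight lifts to matrices. The function [g] of the matrix [(V, v)] plays the
    part of a contraction that tests [A - B]. *)
Lemma trace_bregman_lower_bound n (f f' g : R -> R) (c W : R)
    (A P B Q V : 'M[R]_n) (a b v : 'rV[R]_n) :
  (forall x y : R, (x - y) ^+ 2 / 2 <= (`|x| + `|y| + c) * (f x - f y - f' y * (x - y))) ->
  0 < c -> 0 < W ->
  (forall x, `|g x| <= 1) ->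
  spectral_decomposition A P a -> spectral_decomposition B Q b ->
  V *m V^T = 1%:M ->
  \sum_i `|a 0 i| + \sum_j `|b 0 j| + c * \sum_k g (v 0 k) ^+ 2 <= W ->
  \tr (spectral_fun g V v *m (A - B)) ^+ 2 / (2 * W) <=
  \sum_i f (a 0 i) - \sum_j f (b 0 j) - \tr (spectral_fun f' Q b *m (A - B)).
Proof.
move=> hf c0 W0 g1 dA dB VV hW.
rewrite (klein_identity _ _ dA dB); set T := \tr _.
(* Cauchy-Schwarz enters as [z^2 / (2 w) >= t z e - t^2 e^2 w / 2] in each entry,
   with the value of [t] that is optimal after summation. *)
pose t := T / W.
set E := P *m spectral_fun g V v *m Q^T.
have step : t * T - t ^+ 2 / 2 * W <= t * T - t ^+ 2 / 2 *
    \sum_i \sum_j E i j ^+ 2 * (`|a 0 i| + `|b 0 j| + c).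
  rewrite lerD2l lerN2 ler_wpM2l ?divr_ge0 ?sqr_ge0 //; apply: le_trans hW.
  by apply: weighted_contraction_le => //; [case: dA|case: dB].
have -> : T ^+ 2 / (2 * W) = t * T - t ^+ 2 / 2 * W.
  by rewrite /t; field; rewrite gt_eqF.
apply: le_trans step _; rewrite /T (mxtrace_mulB_spectral _ dA dB).
rewrite !mulr_sumr -sumrB; apply: ler_sum => i _.
rewrite !mulr_sumr -sumrB; apply: ler_sum => j _.
rewrite -/E; move: (E i j) ((P *m Q^T) i j) => e q.
have := hf (a 0 i) (b 0 j).
set x := a 0 i; set y := b 0 j; set d := f x - f y - _.
set w := `|x| + `|y| + c => hd.
have w0 : 0 < w by rewrite /w ltr_wpDl // addr_ge0.
have hd' : (x - y) ^+ 2 / 2 / w <= d by rewrite ler_pdivrMr // [d * w]mulrC.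
apply: le_trans (_ : _ <= q ^+ 2 * ((x - y) ^+ 2 / 2 / w)) _; last first.
  by rewrite ler_wpM2l ?sqr_ge0.
rewrite -subr_ge0.
have -> : q ^+ 2 * ((x - y) ^+ 2 / 2 / w) - (t * (q * e * (x - y)) - t ^+ 2 / 2 * (e ^+ 2 * w))
   = (q * (x - y) - t * e * w) ^+ 2 / (2 * w).
  by field; rewrite gt_eqF.
by rewrite divr_ge0 ?sqr_ge0 // mulr_ge0 // ltW.
Qed.
End TraceBregman.

(** * Singular values and the spectrum of the dilation *)

Section Singular.
Variable R : realType.

Lemma char_poly_spectral n (A P : 'M[R]_n) d : spectral_decomposition A P d ->
  char_poly A = \prod_(x <- codom (d 0)) ('X - x%:P).
Proof.
case=> PP AE.
have -> : char_poly A = char_poly (diag_mx d).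
  rewrite /char_poly.
  pose Pp := map_mx polyC P; pose PTp := map_mx polyC P^T.
  have PTP : PTp *m Pp = 1%:M by rewrite -map_mxM (mulmx1C PP) map_mx1.
  have -> : char_poly_mx A = PTp *m char_poly_mx (diag_mx d) *m Pp.
    rewrite /char_poly_mx AE !map_mxM mulmxBr mulmxBl; congr (_ - _).
    by rewrite mul_mx_scalar -scalemxAl PTP scalemx1.
  rewrite !det_mulmx mulrC mulrA -det_mulmx.
  by rewrite (mulmx1C PTP) det1 mul1r.
rewrite char_poly_trig ?diag_mx_is_trig // /codom big_map big_enum.
by apply: eq_bigr => i _; rewrite mxE eqxx mulr1n.
Qed.

(** Multiplicities determine the list of roots up to order when the polynomial
    splits. *)
Lemma perm_eigenvalues n (A : 'M[R]_n) (s : seq R) :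
  char_poly A = \prod_(x <- s) ('X - x%:P) -> perm_eq (eigenvalues A) s.
Proof.
move=> pE; rewrite /eigenvalues perm_rev; set p := char_poly A.
have p0 : p != 0 by rewrite monic_neq0 // char_poly_monic.
have uroots : uniq (rootsR p) by apply: lt_sorted_uniq; exact: sorted_roots.
have mem_roots y : (y \in rootsR p) = root p y.
  by rewrite -(roots_on_rootsR p0).
apply/allP => y _ /=; apply/eqP.
rewrite -(mu_prod_XsubC y s) -pE -/p count_flatten -map_comp sumnE big_map.
have [yr|yr] := boolP (y \in rootsR p).
  rewrite (bigD1_seq y) //= big1 => [|x /negPf xy].
    by rewrite count_nseq /= eqxx mul1n addn0.
  by rewrite count_nseq /= xy.
rewrite big_seq big1 => [|x xr]; first by rewrite mupNroot -?mem_roots.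
rewrite /= count_nseq /=; case: eqP => // xy.
by rewrite -xy xr in yr.
Qed.

Lemma eigenvalues_sorted n (A : 'M[R]_n) : sorted >=%R (eigenvalues A).
Proof.
rewrite /eigenvalues rev_sorted; set p := char_poly A.
have : sorted <%R (rootsR p) by exact: sorted_roots.
rewrite (sorted_pairwise lt_trans) (sorted_pairwise (fun y x z h => @le_trans _ _ y x z h)).
elim: (rootsR p) => //= x s IH /andP[xs /IH ss].
rewrite pairwise_cat ss andbT; apply/andP; split.
  apply/allrelP => u v /nseqP[-> _] /flatten_mapP[w ws /nseqP[-> _]].
  by apply/ltW/(allP xs).
by elim: (mup x p) => //= k ->; rewrite andbT; apply/allP=> u /nseqP[-> _] /=.
Qed.

Lemma perm_eigenvalues_spectral n (A P : 'M[R]_n) d :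
  spectral_decomposition A P d -> perm_eq (eigenvalues A) (codom (d 0)).
Proof. by move=> /char_poly_spectral/perm_eigenvalues. Qed.

Lemma char_poly_symmetric n (A : 'M[R]_n) : A^T = A ->
  char_poly A = \prod_(x <- eigenvalues A) ('X - x%:P).
Proof.
move=> /real_spectral_theorem[P [d dA]].
by rewrite (char_poly_spectral dA) (perm_big _ (perm_eigenvalues_spectral dA)).
Qed.

Lemma size_eigenvalues n (A : 'M[R]_n) : A^T = A -> size (eigenvalues A) = n.
Proof.
move=> /real_spectral_theorem[P [d dA]].
by rewrite (perm_size (perm_eigenvalues_spectral dA)) size_codom card_ord.
Qed.

(** Both sides are ['X^n] times the determinant of [block_mx 'X%:M A B 1%:M],
    in which the lower left block is eliminated from the right or from the
    left. *)
Lemma sylvester_char_poly m n (A : 'M[R]_(m, n)) (B : 'M[R]_(n, m)) :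
  'X^n * char_poly (A *m B) = 'X^m * char_poly (B *m A).
Proof.
pose a := map_mx polyC A; pose b := map_mx polyC B.
pose M := block_mx 'X%:M a b 1%:M.
have M1 : M *m block_mx 1%:M 0 (- b) 1%:M = block_mx (char_poly_mx (A *m B)) a 0 1%:M.
  rewrite /M mulmx_block !(mulmx1, mulmx0, mul1mx, add0r) mulmxN subrr.
  by rewrite /char_poly_mx map_mxM.
have M2 : block_mx 1%:M 0 (- b) 'X%:M *m M = block_mx 'X%:M a 0 (char_poly_mx (B *m A)).
  rewrite /M mulmx_block !(mulmx1, mulmx0, mul1mx, mul0mx, add0r, addr0) !mulNmx.
  by rewrite scalar_mxC addNr addrC /char_poly_mx map_mxM.
have := congr1 determinant M1; rewrite det_mulmx det_lblock det_ublock !det1 !mulr1.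
have := congr1 determinant M2; rewrite det_mulmx det_lblock det_ublock det1 mul1r !det_scalar.
by rewrite /char_poly => <- <-.
Qed.

Lemma perm_eigenvalues_gram m n (X : 'M[R]_(m, n)) :
  perm_eq (nseq m 0 ++ eigenvalues (X^T *m X)) (nseq n 0 ++ eigenvalues (X *m X^T)).
Proof.
apply: prod_XsubC_eq; rewrite !big_cat !big_nseq /= subr0 !iter_mulr_1.
rewrite -!char_poly_symmetric ?trmx_mul ?trmxK //; exact: sylvester_char_poly.
Qed.

(** The Hermitian dilation (Jordan-Wielandt matrix) of [X]. *)
Definition dilation m n (X : 'M[R]_(m, n)) : 'M[R]_(m + n) := block_mx 0 X X^T 0.

Lemma dilation_sym m n (X : 'M[R]_(m, n)) : (dilation X)^T = dilation X.
Proof. by rewrite /dilation tr_block_mx !trmx0 trmxK. Qed.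

Lemma dilationB m n (X Y : 'M[R]_(m, n)) :
  dilation (X - Y) = dilation X - dilation Y.
Proof. by rewrite /dilation opp_block_mx add_block_mx linearB /= !subr0. Qed.

Lemma dilationZ m n c (X : 'M[R]_(m, n)) :
  dilation (c *: X) = c *: dilation X.
Proof. by rewrite /dilation scale_block_mx !scaler0 linearZ. Qed.

(** The square of the dilation is block diagonal, with blocks [X *m X^T] and
    [X^T *m X]. *)
Lemma perm_eigenvalues_dilation m n (X : 'M[R]_(m, n)) P d :
  spectral_decomposition (dilation X) P d ->
  perm_eq (codom (fun i => d 0 i ^+ 2))
          (eigenvalues (X *m X^T) ++ eigenvalues (X^T *m X)).
Proof.
case=> PP SE.
have dS : spectral_decomposition (dilation X *m dilation X) P (\row_i d 0 i ^+ 2).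
  split=> //; rewrite SE !mulmxA -(mulmxA _ P P^T) PP mulmx1.
  rewrite -(mulmxA _ (diag_mx _) (diag_mx _)) mulmx_diag.
  by congr (_ *m diag_mx _ *m _); apply/rowP => i; rewrite !mxE expr2.
have -> : codom (fun i => d 0 i ^+ 2) = codom ((\row_i d 0 i ^+ 2) 0 : 'I__ -> R).
  by apply: eq_codom => i; rewrite mxE.
apply: prod_XsubC_eq; rewrite -(char_poly_spectral dS).
rewrite big_cat /= -!char_poly_symmetric ?trmx_mul ?trmxK //.
rewrite /dilation mulmx_block !(mulmx0, mul0mx, addr0, add0r).
by rewrite /char_poly char_block_diag_mx det_ublock.
Qed.

(** The definition of [sigma] keeps only the first [minn m n] eigenvalues. The
    others vanish: the list is nonincreasing, and it has at most [m] nonzero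
    entries since they are also those of the [m * m] matrix [X *m X^T]. *)
Lemma sum_sigma (F : R -> R) m n (X : 'M[R]_(m, n)) : F 0 = 0 ->
  all (>= 0) (eigenvalues (X^T *m X)) ->
  \sum_i F (sigma X 0 i) = \sum_(x <- eigenvalues (X^T *m X)) F (Num.sqrt x).
Proof.
move=> F0 s_ge0.
under eq_bigr do rewrite mxE.
set s := eigenvalues (X^T *m X).
have sz : size s = n by rewrite size_eigenvalues // trmx_mul trmxK.
have nz : (count (predC1 0%R) s <= m)%N.
  have := permP (perm_eigenvalues_gram X) (predC1 0%R).
  rewrite !count_cat !count_nseq /= eqxx !mul0n !add0n -/s => ->.
  apply: leq_trans (count_size _ _) _.
  by rewrite size_eigenvalues // trmx_mul trmxK.
have nth0 i : (m <= i)%N -> nth 0 s i = 0.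
  move=> mi; have [sni|ins] := leqP (size s) i; first exact: nth_default.
  apply/eqP; apply: contraTT nz => si; rewrite -ltnNge.
  apply: (@leq_trans (count (predC1 0%R) (take i.+1 s))); last first.
    by rewrite -[in X in (_ <= X)%N](cat_take_drop i.+1 s) count_cat leq_addr.
  suff /eqP-> : count (predC1 0%R) (take i.+1 s) == size (take i.+1 s).
    by rewrite size_take_min (minn_idPl ins) ltnS.
  rewrite -all_count; apply/(all_nthP 0) => j; rewrite size_take_min => jlt.
  have ji : (j <= i)%N by move: jlt; rewrite leq_min ltnS => /andP[].
  rewrite nth_take ?ltnS //= gt_eqF //.
  have : nth 0 s j >= nth 0 s i.
    apply: (sorted_leq_nth (rev_trans le_trans) (@lexx _ _) 0 (eigenvalues_sorted _)) => //.
    by rewrite inE; apply: leq_ltn_trans ji ins.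
  apply: lt_le_trans; rewrite lt_def si.
  by apply: (all_nthP 0 s_ge0).
rewrite (big_nth 0) sz big_mkord.
rewrite [RHS](bigID (fun i : 'I_n => (i < m)%N)) /= [X in _ + X]big1 ?addr0; last first.
  by move=> i; rewrite -leqNgt => /nth0 ->; rewrite sqrtr0.
have mn : (minn m n <= n)%N by exact: geq_minr.
rewrite (big_ord_widen_cond n xpredT (fun i => F (Num.sqrt (nth 0 s i)))) //.
by apply: eq_bigl => i; rewrite leq_min ltn_ord andbT.
Qed.

(** The spectrum of the dilation is made of the singular values and their
    opposites, up to zeros: the squares of its elements are the eigenvalues of
    the two Gram matrices, which agree up to zeros. *)
Theorem sum_dilation_spectrum (F : R -> R) m n (X : 'M[R]_(m, n)) P d :
  F 0 = 0 -> spectral_decomposition (dilation X) P d ->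
  \sum_i F `|d 0 i| = 2 * \sum_i F (sigma X 0 i).
Proof.
move=> F0 dX; have permX := perm_eigenvalues_dilation dX.
have s_ge0 : all (>= 0) (eigenvalues (X^T *m X)).
  apply/allP => x xs.
  have : x \in codom (fun i => d 0 i ^+ 2) by rewrite (perm_mem permX) mem_cat xs orbT.
  by case/codomP=> i ->; rewrite sqr_ge0.
rewrite sum_sigma //.
have -> : \sum_i F `|d 0 i| = \sum_(x <- codom (fun i => d 0 i ^+ 2)) F (Num.sqrt x).
  by rewrite /codom big_map big_enum; apply: eq_bigr => i _; rewrite sqrtr_sqr.
rewrite (perm_big _ permX) big_cat /= mulr_natl mulr2n; congr (_ + _).
have : \sum_(x <- nseq m 0 ++ eigenvalues (X^T *m X)) F (Num.sqrt x) =
       \sum_(x <- nseq n 0 ++ eigenvalues (X *m X^T)) F (Num.sqrt x).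
  by apply: perm_big; exact: perm_eigenvalues_gram.
have z k : \sum_(x <- nseq k 0) F (Num.sqrt x) = 0.
  by rewrite big1_seq // => x /nseqP[-> _]; rewrite sqrtr0.
by rewrite !big_cat /= !z !add0r.
Qed.
End Singular.

(** * The scalar inequality *)

Section Hypentropy.
Variables (R : realType) (beta : R).
Hypothesis beta_gt0 : 0 < beta.

Definition hypentropy (x : R) := (`|x| + beta) * ln (`|x| / beta + 1) - `|x|.
Definition hypentropy_deriv (x : R) := Num.sg x * ln (`|x| / beta + 1).

(** The relative entropy dominates the squared Hellinger distance
    [(sqrt p - sqrt q)^2], by [ln r <= r - 1] at [r = sqrt (q / p)], and
    [(sqrt p + sqrt q)^2 <= 2 (p + q)]. *)
Lemma relative_entropy_ge (p q : R) : 0 < p -> 0 < q ->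
  (p - q) ^+ 2 / 2 <= (p + q) * (p * ln (p / q) - p + q).
Proof.
move=> p0 q0.
pose r := Num.sqrt (q / p).
have qp0 : 0 < q / p by rewrite divr_gt0.
have r0 : 0 < r by rewrite sqrtr_gt0.
have r2 : r ^+ 2 = q / p by rewrite sqr_sqrtr // ltW.
have lnE : ln (p / q) = - 2 * ln r.
  rewrite -[p / q]invrK invf_div -r2 lnV ?posrE ?exprn_gt0 // lnXn //.
  by rewrite mulNr mulr_natl.
have lnr : ln r <= r - 1.
  by rewrite -[X in ln X](subrK 1) addrC; apply: le_ln1Dx; rewrite ltrBrDl subrr.
have qE : q = p * r ^+ 2 by rewrite r2; field; rewrite gt_eqF.
have h1 : p * (1 - r) ^+ 2 <= p * ln (p / q) - p + q.
  rewrite lnE qE -subr_ge0.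
  have -> : p * (- 2 * ln r) - p + p * r ^+ 2 - p * (1 - r) ^+ 2 =
    2 * p * (r - 1 - ln r) by ring.
  by rewrite mulr_ge0 ?mulr_ge0 ?subr_ge0 // ltW.
apply: le_trans (_ : _ <= (p + q) * (p * (1 - r) ^+ 2)) _; last first.
  by rewrite ler_wpM2l // addr_ge0 // ltW.
rewrite qE -subr_ge0.
have -> : (p + p * r ^+ 2) * (p * (1 - r) ^+ 2) - (p - p * r ^+ 2) ^+ 2 / 2 =
  (p * (1 - r) ^+ 2) ^+ 2 / 2 by field.
by rewrite divr_ge0 ?sqr_ge0.
Qed.

Lemma ln_shift x : 0 <= x -> ln (x / beta + 1) = ln (x + beta) - ln beta.
Proof.
move=> x0; rewrite -ln_div ?posrE ?ltr_wpDl //; congr ln.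
by field; rewrite gt_eqF.
Qed.

(** On one side of the origin the divergence is the relative entropy of
    [x + beta] with respect to [y + beta]. *)
Lemma hypentropy_bregman_same (x y : R) : 0 <= x -> 0 <= y ->
  (x - y) ^+ 2 / 2 <= (x + y + 2 * beta) *
    (hypentropy x - hypentropy y - ln (y / beta + 1) * (x - y)).
Proof.
move=> x0 y0.
have p0 : 0 < x + beta by rewrite ltr_wpDl.
have q0 : 0 < y + beta by rewrite ltr_wpDl.
have := relative_entropy_ge p0 q0.
rewrite /hypentropy !ger0_norm // !ln_shift // ln_div //.
have -> : x + beta - (y + beta) = x - y by ring.
by congr (_ <= _); ring.
Qed.

(** This is the divergence from [y] to [- x]. It splits at the origin, by the
    three-point identity, into the divergences from [0] to [x] and from [y] to
    [0], which control [x^2] and [y^2], and a cross term [x * ln (y / beta + 1)],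
    which controls [x * y]. *)
Lemma hypentropy_bregman_opposite (x y : R) : 0 <= x -> 0 <= y ->
  (x + y) ^+ 2 / 2 <= (x + y + 2 * beta) *
    (hypentropy x - hypentropy y + ln (y / beta + 1) * (x + y)).
Proof.
move=> x0 y0; set l := ln (y / beta + 1).
have b0 := ltW beta_gt0.
have q0 : 0 < y + beta by rewrite ltr_wpDl.
have hyp0 : hypentropy 0 = 0.
  by rewrite /hypentropy normr0 mul0r !add0r ln1 mulr0 subr0.
have hx := hypentropy_bregman_same x0 (lexx 0).
have hy := hypentropy_bregman_same (lexx 0) y0.
rewrite mul0r add0r ln1 mul0r hyp0 !subr0 addr0 in hx.
rewrite -/l hyp0 !sub0r mulrN opprK sqrrN add0r in hy.
have ll : y <= (y + beta) * l.
  rewrite /l ln_shift // -[_ - _]opprB -ln_div //.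
  have : ln (beta / (y + beta)) <= beta / (y + beta) - 1.
    rewrite -[X in ln X](subrK 1) addrC; apply: le_ln1Dx.
    by rewrite ltrBrDl subrr divr_gt0.
  move=> /(ler_wpM2l (ltW q0)).
  have -> : (y + beta) * (beta / (y + beta) - 1) = - y by field; rewrite gt_eqF.
  by rewrite mulrN lerNr.
have l0 : 0 <= l by rewrite -(pmulr_rge0 _ q0); apply: le_trans ll.
have hx0 : 0 <= hypentropy x.
  have s0 : 0 < x + 2 * beta by rewrite ltr_wpDl // mulr_gt0.
  by rewrite -(pmulr_rge0 _ s0); apply: le_trans hx; rewrite divr_ge0 ?sqr_ge0.
have hy0 : 0 <= - hypentropy y + l * y.
  have s0 : 0 < y + 2 * beta by rewrite ltr_wpDl // mulr_gt0.
  by rewrite -(pmulr_rge0 _ s0); apply: le_trans hy; rewrite divr_ge0 ?sqr_ge0.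
(* Cross terms of the product with [x + y + 2 * beta]; the square terms are [hx]
   and [hy], and the double product comes from [ll]. *)
have e1 : 0 <= y * hypentropy x by rewrite mulr_ge0.
have e2 : 0 <= x * (- hypentropy y + l * y) by rewrite mulr_ge0.
have e3 : x * y <= x * ((y + beta) * l) by rewrite ler_wpM2l.
have e4 : 0 <= x * x * l by rewrite !mulr_ge0.
have e5 : 0 <= x * beta * l by rewrite !mulr_ge0.
nra.
Qed.

Theorem hypentropy_bregman (x y : R) :
  (x - y) ^+ 2 / 2 <= (`|x| + `|y| + 2 * beta) *
    (hypentropy x - hypentropy y - hypentropy_deriv y * (x - y)).
Proof.
have hypE z : hypentropy `|z| = hypentropy z by rewrite /hypentropy normr_id.
wlog y0 : x y / 0 <= y.
  move=> H; have [/H//|y0] := leP 0 y.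
  have := H (- x) (- y); rewrite oppr_ge0 => /(_ (ltW y0)).
  rewrite /hypentropy_deriv sgrN !normrN -(hypE (- x)) -(hypE (- y)) !normrN !hypE.
  have -> : (- x - - y) = - (x - y) by ring.
  by rewrite sqrrN !mulNr mulrN opprK.
have -> : hypentropy_deriv y = ln (y / beta + 1).
  rewrite /hypentropy_deriv ger0_norm //; have [->|yn0] := eqVneq y 0.
    by rewrite mul0r add0r ln1 mulr0.
  by rewrite gtr0_sg ?mul1r // lt_def yn0.
rewrite -(hypE x) (ger0_norm y0); have [x0|x0] := leP 0 x.
  by rewrite ger0_norm //; apply: hypentropy_bregman_same.
have x0' : 0 <= - x by rewrite oppr_ge0 ltW.
rewrite ltr0_norm //; have := hypentropy_bregman_opposite x0' y0.
have -> : - x + y = - (x - y) by ring.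
by rewrite sqrrN mulrN.
Qed.

End Hypentropy.

(** * The nuclear norm and the strong tangent inequality *)

Section Nuclear.
Variable R : realType.

Lemma normr_sg_le1 (x : R) : `|Num.sg x| <= 1.
Proof. by rewrite normr_sg; case: (x != 0). Qed.

Lemma sum_norm_dilation m n (X : 'M[R]_(m, n)) P d :
  spectral_decomposition (dilation X) P d ->
  \sum_i `|d 0 i| = 2 * nuclear_norm X.
Proof. exact: (@sum_dilation_spectrum R id). Qed.

(** The sum counts the nonzero eigenvalues, two for each nonzero singular
    value. *)
Lemma sum_sg_dilation_le m n (X : 'M[R]_(m, n)) P d :
  spectral_decomposition (dilation X) P d ->
  \sum_i Num.sg (d 0 i) ^+ 2 <= 2 * (minn m n)%:R.
Proof.
move=> dX; have sg0 : Num.sg (0 : R) ^+ 2 = 0 by rewrite sgr0 expr0n.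
have -> : \sum_i Num.sg (d 0 i) ^+ 2 = \sum_i Num.sg `|d 0 i| ^+ 2.
  by apply: eq_bigr => i _; rewrite !sqr_sg normr_eq0.
rewrite (sum_dilation_spectrum (F := fun x => Num.sg x ^+ 2) sg0 dX) ler_pM2l //.
rewrite -[X in _ <= X%:R]card_ord -sum1_card natr_sum; apply: ler_sum => i _.
by rewrite sqr_sg; case: (_ != 0).
Qed.

Lemma nuclear_norm_trace m n (H : 'M[R]_(m, n)) V v :
  spectral_decomposition (dilation H) V v ->
  \tr (spectral_fun Num.sg V v *m dilation H) = 2 * nuclear_norm H.
Proof.
move=> dH; rewrite (mxtrace_spectral_fun_self _ dH) -(sum_norm_dilation dH).
by apply: eq_bigr => i _; rewrite [RHS]normrEsg mulrC.
Qed.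

Lemma dilation_spectrum m n (X : 'M[R]_(m, n)) :
  exists P d, spectral_decomposition (dilation X) P d.
Proof. exact/real_spectral_theorem/dilation_sym. Qed.

(** Together with [nuclear_norm_trace], this is the duality of the nuclear and
    operator norms: the sign of the dilation of [H] is the optimal test matrix
    for [H] itself. *)
Lemma nuclear_norm_dual_le m n (X H : 'M[R]_(m, n)) V v :
  spectral_decomposition (dilation H) V v ->
  \tr (spectral_fun Num.sg V v *m dilation X) <= 2 * nuclear_norm X.
Proof.
case=> VV _; have [P [d dX]] := dilation_spectrum X.
by rewrite -(sum_norm_dilation dX); exact: (mxtrace_contraction_le v normr_sg_le1 dX VV).
Qed.

Lemma nuclear_norm_convex m n (X Y : 'M[R]_(m, n)) t : 0 <= t <= 1 ->
  nuclear_norm (Y + t *: (X - Y)) <= (1 - t) * nuclear_norm Y + t * nuclear_norm X.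
Proof.
move=> /andP[t0 t1]; set Z := Y + _.
have [V [v dZ]] := dilation_spectrum Z.
rewrite -(ler_pM2l (ltr0n R 2)) -(nuclear_norm_trace dZ).
have -> : Z = t *: X - (- (1 - t)) *: Y.
  by apply/matrixP => i j; rewrite !mxE; ring.
rewrite dilationB !dilationZ mulmxBr linearB /= -!scalemxAr !linearZ /=.
move: (nuclear_norm_dual_le X dZ) (nuclear_norm_dual_le Y dZ).
move: (nuclear_norm X) (nuclear_norm Y) => x y.
move: (\tr (_ *m dilation X)) (\tr (_ *m dilation Y)) => tx ty.
move=> /(ler_wpM2l t0) htx; rewrite -subr_ge0 in t1; move=> /(ler_wpM2l t1) hty.
clear -htx hty; lra.
Qed.

Definition hypentropy_trace m n (beta : R) (X : 'M[R]_(m, n)) : R :=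
  \sum_i hypentropy beta (sigma X 0 i).

Lemma sum_hypentropy_dilation m n beta (X : 'M[R]_(m, n)) P d :
  spectral_decomposition (dilation X) P d ->
  \sum_i hypentropy beta (d 0 i) = 2 * hypentropy_trace beta X.
Proof.
move=> dX; have h0 : hypentropy beta 0 = 0.
  by rewrite /hypentropy normr0 mul0r !add0r ln1 mulr0 subr0.
rewrite -(sum_dilation_spectrum h0 dX).
by apply: eq_bigr => i _; rewrite /hypentropy normr_id.
Qed.

(** The functional [L] is the derivative of [hypentropy_trace beta] at [Z]; its
    homogeneity lets the linear terms of two opposite directions cancel. The
    step [s] is separated from the direction [H] so that points on both sides
    of [Z] on a line are compared through one nuclear norm. *)
Lemma hypentropy_strong_tangent m n (beta D : R) (Z : 'M[R]_(m, n)) :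
  0 < beta -> 0 < D -> nuclear_norm Z <= D ->
  exists2 L : 'M[R]_(m, n) -> R, (forall c H, L (c *: H) = c * L H) &
  forall X s H, nuclear_norm X <= D -> X - Z = s *: H ->
    s ^+ 2 * (nuclear_norm H ^+ 2 / (4 * (D + (minn m n)%:R * beta)))
    <= hypentropy_trace beta X - hypentropy_trace beta Z - L (X - Z).
Proof.
set K := D + _ => beta_gt0 D_gt0 ZD; have [Q [b dZ]] := dilation_spectrum Z.
exists (fun H => \tr (spectral_fun (hypentropy_deriv beta) Q b *m dilation H) / 2)
  => [c H|X s H XD XZ].
  by rewrite dilationZ -scalemxAr linearZ /= mulrA.
have [P [a dX]] := dilation_spectrum X; have [V [v dH]] := dilation_spectrum H.
have K0 : 0 < K by rewrite ltr_wpDr // mulr_ge0 // ltW.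
have WK : \sum_i `|a 0 i| + \sum_j `|b 0 j|
    + 2 * beta * \sum_k Num.sg (v 0 k) ^+ 2 <= 4 * K.
  rewrite (sum_norm_dilation dX) (sum_norm_dilation dZ) /K.
  have := ler_wpM2l (ltW beta_gt0) (sum_sg_dilation_le dH).
  move: XD ZD; clear; move: (nuclear_norm X) (nuclear_norm Z) (\sum_k _) => x z r.
  by move: (minn m n)%:R => k; lra.
have c0 : 0 < 2 * beta by rewrite mulr_gt0.
have W0 : 0 < 4 * K by rewrite mulr_gt0.
have := trace_bregman_lower_bound (hypentropy_bregman beta_gt0) c0 W0
  normr_sg_le1 dX dZ (proj1 dH) WK.
rewrite !(sum_hypentropy_dilation _ dX, sum_hypentropy_dilation _ dZ).
rewrite -dilationB {1}XZ dilationZ -scalemxAr linearZ /= (nuclear_norm_trace dH).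
have -> : (s * (2 * nuclear_norm H)) ^+ 2 / (2 * (4 * K)) =
   2 * (s ^+ 2 * (nuclear_norm H ^+ 2 / (4 * K))) by field; rewrite gt_eqF.
move: (hypentropy_trace _ X) (hypentropy_trace _ Z) (\tr _) (s ^+ 2 * _) => x z T M.
by clear; lra.
Qed.

(** The bound at [Z] is used with the steps [1 - t] and [- t] along [X - Y]: the
    terms in [L] cancel when the two are weighted by [t] and [1 - t]. *)
Lemma hypentropy_trace_segment m n (beta D t : R) (X Y : 'M[R]_(m, n)) :
  0 < beta -> 0 < D -> 0 <= t <= 1 ->
  nuclear_norm X <= D -> nuclear_norm Y <= D ->
  hypentropy_trace beta (Y + t *: (X - Y))
    + t * (1 - t) * (nuclear_norm (X - Y) ^+ 2 / (4 * (D + (minn m n)%:R * beta)))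
  <= t * hypentropy_trace beta X + (1 - t) * hypentropy_trace beta Y.
Proof.
move=> beta_gt0 D_gt0 t01 XD YD; have /andP[t0 t1] := t01.
rewrite -subr_ge0 in t1; set Z := Y + _; set M := _ / _.
have ZD : nuclear_norm Z <= D.
  apply: le_trans (nuclear_norm_convex X Y t01) _.
  have := ler_wpM2l t0 XD; have := ler_wpM2l t1 YD.
  by move: (_ * nuclear_norm X) (_ * nuclear_norm Y) => x y; clear; lra.
have [L LZ tang] := hypentropy_strong_tangent beta_gt0 D_gt0 ZD.
have XZ : X - Z = (1 - t) *: (X - Y).
  by rewrite /Z opprD addrA scalerBl scale1r.
have YZ : Y - Z = (- t) *: (X - Y).
  by rewrite /Z opprD addrA subrr add0r scaleNr.
move: (tang X _ _ XD XZ) (tang Y _ _ YD YZ); rewrite XZ YZ !LZ -/M.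
move: (hypentropy_trace _ X) (hypentropy_trace _ Y) (hypentropy_trace _ Z).
move: M (L _) => M l x y z /(ler_wpM2l t0) hx /(ler_wpM2l t1) hy.
by clear -hx hy; lra.
Qed.
End Nuclear.

(** * Strong convexity for arbitrary subgradients *)

Lemma le_of_shrink (R : realFieldType) (c r : R) : 0 <= c ->
  (forall t, 0 < t < 1 -> (1 - t) * c <= r) -> c <= r.
Proof.
move=> c_ge0 key.
have r_ge0 : 0 <= r.
  have : 0 < (2^-1 : R) < 1 by lra.
  by move=> /key; lra.
rewrite leNgt; apply/negP => rc.
have c0 : 0 < c by apply: le_lt_trans rc.
(* For this [t], [(1 - t) * c] is the midpoint of [r] and [c]. *)
have : 0 < (c - r) / (2 * c) < 1.
  by rewrite divr_gt0 ?subr_gt0 ?mulr_gt0 //= ltr_pdivrMr ?mulr_gt0 //; lra.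
move=> /key.
have -> : (1 - (c - r) / (2 * c)) * c = (c + r) / 2 by field; rewrite gt_eqF.
lra.
Qed.

Theorem theorem3 (R : realType) (m n : nat) (alpha beta D : R)
    (halpha : 0 < alpha) (hbeta : 0 < beta) (hD : 0 < D) :
  strongly_convex (alpha / (2 * (D + (minn m n)%:R * beta)))
    nuclear_norm (nuclear_ball m n D) (phi alpha beta \o sigma).
Proof.
move=> X Y XD YD G subG.
have phiE Z : (phi alpha beta \o sigma) Z = alpha * hypentropy_trace beta Z by [].
have K0 : 0 < D + (minn m n)%:R * beta.
  by rewrite ltr_wpDr // mulr_ge0 // ltW.
have -> : alpha / (2 * (D + (minn m n)%:R * beta)) / 2 * nuclear_norm (X - Y) ^+ 2
    = alpha * (nuclear_norm (X - Y) ^+ 2 / (4 * (D + (minn m n)%:R * beta))).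
  by field; rewrite gt_eqF.
rewrite !phiE addrC -lerBrDr; apply: le_of_shrink => [|t /andP[t0 t1]].
  by rewrite mulr_ge0 ?(ltW halpha) // divr_ge0 ?sqr_ge0 // mulr_ge0 // ltW.
have t01 : 0 <= t <= 1 by rewrite !ltW.
(* At [Z] the value of the function lies above the affine minorant given by [G]
   and below the chord, by a quadratic margin. *)
pose Z := Y + t *: (X - Y); have := subG Z; rewrite !phiE.
have := hypentropy_trace_segment hbeta hD t01 XD YD; rewrite -/Z.
have -> : frobenius G (Z - Y) = t * frobenius G (X - Y).
  rewrite /frobenius mulr_sumr; apply: eq_bigr => i _.
  rewrite mulr_sumr; apply: eq_bigr => j _.
  by rewrite /Z !mxE; ring.
move: (_ / _) (frobenius _ _) => M g.
move: (hypentropy_trace _ X) (hypentropy_trace _ Y) (hypentropy_trace _ Z).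
move=> x y z /(ler_wpM2l (ltW halpha)) seg hz.
by rewrite -(ler_pM2l t0); clear -hz seg; lra.
Qed.
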